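(* There is a constant $c>0$ such that the following holds for the machine $M$ defined in the context. Let $n\ge 1$, $\vec u\in\mathbb Z^2$ and $(q[\vec v],x)\in X_Q\times\Sigma^{\mathbb Z^2}$ be such that $\vec v\in\vec u+[0,n-1]^2$. Then there exists $t\le c\,n^4$ with $M^t(q[\vec v],x)=(p[\vec w],y)$ and $\vec w\notin\vec u+[0,n-1]^2$.
   Context: Intervals $[a,b]$ are integer intervals. For a finite set $Q$ and a symbol $\#\notin Q$, $X_Q\subset (Q\cup\{\#\})^{\mathbb Z^2}$ is the set of configurations in which at most one coordinate carries an element of $Q$; for $q\in Q$ and $\vec v\in\mathbb Z^2$, $q[\vec v]\in X_Q$ is the unique configuration with value $q$ at $\vec v$. **The machine $M$** (in the moving head model, a map on $X_Q\times\Sigma^{\mathbb Z^2}$). $\Sigma=\{0,1\}$, $Q=\{\uparrow,\uparrow^*,\rightarrow,\leftarrow,\downarrow\}$. The states $\uparrow,\rightarrow,\leftarrow,\downarrow$ are identified with the unit vectors $(0,1),(1,0),(-1,0),(0,-1)$; for a unit vector $u$ let $R(u)$ be its clockwise rotation by 90 degrees (so $R(0,1)=(1,0)$). Headless configurations $(\#^{\mathbb Z^2},x)$ are fixed. One step from $(q[\vec v],x)$ consists of three phases. Phase 1: if $q=u\neq\,\uparrow^*$, $x_{\vec v}=0$, $x_{\vec v+u+R(u)}=1$ and $x_{\vec v+u}=x_{\vec v+R(u)}$, then (left turn) the state becomes $-R(u)$, $x_{\vec v}$ becomes $1$ and $x_{\vec v+u+R(u)}$ becomes $0$; if $q=u\ne\,\uparrow^*$,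 $x_{\vec v}=1$, $x_{\vec v+R(u)-u}=0$ and $x_{\vec v+R(u)}=x_{\vec v-u}$, then (right turn) the state becomes $R(u)$, $x_{\vec v}$ becomes $0$ and $x_{\vec v+R(u)-u}$ becomes $1$; otherwise nothing changes. Phase 2: if the current state is a unit vector $u$, the head moves from $\vec v$ to $\vec v+u$; if it is $\uparrow^*$, the head does not move. Phase 3: state $\uparrow$ is changed to $\uparrow^*$ and $\uparrow^*$ to $\uparrow$; other states are unchanged. *)

(* Defs.v *)
From mathcomp Require Import all_boot all_order all_algebra.
From mathcomp Require Import boolp.

Set Implicit Arguments.
Unset Strict Implicit.
Unset Printing Implicit Defensive.

Import Order.TTheory GRing.Theory Num.Theory.
Local Open Scope ring_scope.

Notation Z2 := (int * int)%type.

(* The symbol # is None; a value h v : option Q used as a proposition means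
   that h carries an element of Q at v. *)
Definition at_most_one_head (Q : Type) (h : Z2 -> option Q) : Prop :=
  forall v w : Z2, h v -> h w -> v = w.

Definition X (Q : Type) := {h : Z2 -> option Q | at_most_one_head h}.

Lemma at_most_one_head_at (Q : Type) (q : Q) (v : Z2) :
  at_most_one_head (fun z => if z == v then Some q else None).
Proof.
by move=> z w; case: (z =P v) => // -> _; case: (w =P v) => // ->.
Qed.

(* q[v] *)
Definition head_at (Q : Type) (q : Q) (v : Z2) : X Q :=
  exist (@at_most_one_head Q) _ (@at_most_one_head_at Q q v).

Lemma at_most_one_head_none (Q : Type) :
  at_most_one_head (fun _ : Z2 => @None Q).
Proof. by []. Qed.

Definition headless (Q : Type) : X Q :=
  exist (@at_most_one_head Q) _ (@at_most_one_head_none Q).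

(* Some (q, v) if h = q[v], and None if h is the headless configuration; see
   head_of_at, head_of_headless and X_cases below. *)
Definition head_of (Q : Type) (h : X Q) : option (Q * Z2) :=
  if pselect (exists qv : Q * Z2, h = head_at qv.1 qv.2) is left E
  then Some (projT1 (cid E)) else None.

Lemma head_at_inj (Q : Type) (q p : Q) (v w : Z2) :
  head_at q v = head_at p w -> q = p /\ v = w.
Proof.
move=> e; have /= := congr1 (fun h : X Q => sval h v) e; rewrite eqxx.
by case: eqP => // -> [->].
Qed.

Lemma head_of_at (Q : Type) (q : Q) (v : Z2) :
  head_of (head_at q v) = Some (q, v).
Proof.
rewrite /head_of; case: pselect => [E|[]]; last by exists (q, v).
by case: (cid E) => -[p w] /= e; have [-> ->] := head_at_inj e.
Qed.

Lemma head_of_headless (Q : Type) : head_of (headless Q) = None.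
Proof.
rewrite /head_of; case: pselect => // -[[q v]] /=.
by move=> e; have /= := congr1 (fun h : X Q => sval h v) e; rewrite eqxx.
Qed.

Lemma X_cases (Q : Type) (h : X Q) :
  h = headless Q \/ exists q v, h = head_at q v.
Proof.
have X_ext (h1 h2 : X Q) : sval h1 =1 sval h2 -> h1 = h2.
  case: h1 h2 => [f1 P1] [f2 P2] /= /funext f12.
  by subst f2; rewrite (Prop_irrelevance P1 P2).
have [[v]|nE] := pselect (exists v, sval h v).
  case hv: (sval h v) => [q|//] _; right; exists q, v.
  apply: X_ext => z /=; case: (z =P v) => [->//|zv].
  by case hz: (sval h z) => [p|//]; case: zv; apply: (svalP h);
    rewrite ?hz ?hv.
left; apply: X_ext => z /=.
by case hz: (sval h z) => [p|//]; case: nE; exists z; rewrite hz.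
Qed.

Inductive state := Up | UpStar | Right | Left | Down.

(* The identification of the four states other than UpStar with the unit
   vectors, in both directions. *)
Definition vec_of (q : state) : option Z2 :=
  match q with
  | Up => Some (0, 1)
  | UpStar => None
  | Right => Some (1, 0)
  | Left => Some (-1, 0)
  | Down => Some (0, -1)
  end.

(* The last branch stands for (0, -1); the value is irrelevant when u is not a
   unit vector. *)
Definition state_of (u : Z2) : state :=
  if u == (0, 1) then Up
  else if u == (1, 0) then Right
  else if u == (-1, 0) then Left
  else Down.

Lemma vec_ofK (q : state) (u : Z2) : vec_of q = Some u -> state_of u = q.
Proof. by case: q => //= -[<-]. Qed.

(* Clockwise rotation by 90 degrees. *)
Definition R (u : Z2) : Z2 := (u.2, - u.1).

Lemma vec_of_turns (q : state) (u : Z2) : vec_of q = Some u ->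
  vec_of (state_of (R u)) = Some (R u) /\
  vec_of (state_of (- R u)) = Some (- R u).
Proof. by case: q => //= -[<-]. Qed.

(* Tapes are functions Z2 -> bool, where true is the symbol 1. *)
Definition situation := (state * Z2 * (Z2 -> bool))%type.

Definition write (x : Z2 -> bool) (v : Z2) (b : bool) : Z2 -> bool :=
  fun z => if z == v then b else x z.

Definition phase1 (s : situation) : situation :=
  let: (q, v, x) := s in
  if vec_of q is Some u then
    if [&& x v == false, x (v + u + R u) == true
         & x (v + u) == x (v + R u)]
    then (state_of (- R u), v,
          write (write x v true) (v + u + R u) false)
    else if [&& x v == true, x (v + R u - u) == false
              & x (v + R u) == x (v - u)]
    then (state_of (R u), v,
          write (write x v false) (v + R u - u) true)
    else s
  else s.

Definition phase2 (s : situation) : situation :=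
  let: (q, v, x) := s in
  if vec_of q is Some u then (q, v + u, x) else s.

Definition phase3 (s : situation) : situation :=
  let: (q, v, x) := s in
  match q with
  | Up => (UpStar, v, x)
  | UpStar => (Up, v, x)
  | _ => s
  end.

Definition M (hx : X state * (Z2 -> bool)) : X state * (Z2 -> bool) :=
  if head_of hx.1 is Some (q, v) then
    let: (q', v', x') := phase3 (phase2 (phase1 (q, v, hx.2))) in
    (head_at q' v', x')
  else hx.

Lemma M_head_at (q : state) (v : Z2) (x : Z2 -> bool) :
  M (head_at q v, x) =
  let: (q', v', x') := phase3 (phase2 (phase1 (q, v, x))) in
  (head_at q' v', x').
Proof. by rewrite /M head_of_at. Qed.

(* u + [0, n - 1]^2 *)
Definition square (u : Z2) (n : nat) : pred Z2 :=
  [pred w : Z2 | (w.1 - u.1 \in `[0, n%:Z - 1]) &&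
                 (w.2 - u.2 \in `[0, n%:Z - 1])].

(* Main.v *)
(* A turn at [v] from direction [u] to direction [u'] carries a 1 along
   [u' - u], with [v] as source (right turn) or target (left turn). Hence, if
   the head is at [v] with direction [u], the sum of |z|^2 over the 1s at z,
   minus 2 (v . u), changes by -2 when the head goes straight, by -4 at a left
   turn and by 0 at a right turn. Two right turns never occur in a row, so this
   quantity drops at least once in any two moves. As long as the head stays in
   the square, only cells of a slightly larger square are rewritten, and there
   the quantity is O(n^4). *)

Require Import Defs.
From mathcomp Require Import all_boot all_order all_algebra.
From mathcomp Require Import boolp zify ring lra.

Set Implicit Arguments.
Unset Strict Implicit.
Unset Printing Implicit Defensive.

Import Order.TTheory GRing.Theory Num.Theory.
Local Open Scope ring_scope.

Definition step (s : situation) : situation := phase3 (phase2 (phase1 s)).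

Lemma iter_M (t : nat) (q : state) (v : Z2) (x : Z2 -> bool) :
  iter t M (head_at q v, x) =
  let: (p, w, y) := iter t step (q, v, x) in (head_at p w, y).
Proof.
elim: t => //= t ->; case: (iter t step _) => -[p w] y.
by rewrite M_head_at.
Qed.

Definition dot (a b : Z2) : int := a.1 * b.1 + a.2 * b.2.

(** The default gives [UpStar] the direction of [Up], so that a pause changes only the [is_star]
    term of [potential]. *)
Definition dir (q : state) : Z2 := if vec_of q is Some u then u else (0, 1).

Definition is_star (q : state) : bool := if q is UpStar then true else false.

Definition turns_left (u v : Z2) (x : Z2 -> bool) : bool :=
  [&& x v == false, x (v + u + R u) == true & x (v + u) == x (v + R u)].

Definition turns_right (u v : Z2) (x : Z2 -> bool) : bool :=
  [&& x v == true, x (v + R u - u) == false & x (v + R u) == x (v - u)].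

Lemma big_write (B : seq Z2) (F : Z2 -> int) (x : Z2 -> bool) (v : Z2)
    (b : bool) :
  uniq B -> v \in B ->
  \sum_(z <- B | write x v b z) F z =
  \sum_(z <- B | x z) F z + (b%:R - (x v)%:R) * F v.
Proof.
move=> uB vB; rewrite big_mkcond [in RHS]big_mkcond /=.
rewrite (bigD1_seq v) //= [in RHS](bigD1_seq v) //= {1}/write eqxx.
under eq_bigr => z zv do rewrite /write (negPf zv).
by case: b; case: (x v) => /=; ring.
Qed.

(* The quadratic quantity, with two corrections that make it drop at every step:
   one pays for a right turn ahead, the other for the pause in [UpStar]. *)
Definition potential (B : seq Z2) (o : Z2) (s : situation) : int :=
  let: (q, v, x) := s in
  2 * (\sum_(z <- B | x z) dot (z - o) (z - o) - 2 * dot (v - o) (dir q)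
       + (turns_right (dir q) v x)%:R) + (is_star q)%:R.

(** The new state matters only through its direction: the passage from [Up] to [UpStar] in the last
    phase is invisible to [dir]. *)
Lemma step_move (q : state) (v : Z2) (x : Z2 -> bool) : ~~ is_star q ->
  let u := dir q in
  exists q', step (q, v, x) =
    (if turns_left u v x
    then (q', v + dir q', write (write x v true) (v + u + R u) false)
    else if turns_right u v x
    then (q', v + dir q', write (write x v false) (v + R u - u) true)
    else (q', v + dir q', x))
  /\ dir q' =
    (if turns_left u v x then - R u else
     if turns_right u v x then R u else u).
Proof.
case: q => //= _; rewrite /step /phase1 /=;
  rewrite -/(turns_left _ _ _) -/(turns_right _ _ _) /dir /=;
  case: ifP => [_|_]; [|case: ifP => _|
    |case: ifP => _| |case: ifP => _| |case: ifP => _];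
  by [exists UpStar|exists Right|exists Left|exists Down].
Qed.

Lemma dir_unit (q : state) : dot (dir q) (dir q) = 1.
Proof. by case: q. Qed.

(** A second right turn would need a 1 at [v + R u] and a 0 at [v - u]. The first turn requires
    these two cells to agree and rewrites neither of them. *)
Lemma no_two_right_turns (u v : Z2) (x : Z2 -> bool) : u != 0 ->
  turns_right u v x ->
  ~~ turns_right (R u) (v + R u) (write (write x v false) (v + R u - u) true).
Proof.
move=> u0 /and3P[_ /eqP xd /eqP xe].
have RRu : R (R u) = - u by case: u {u0 xd xe} => a b.
have Ru0 : R u != 0.
  by apply: contra u0 => /eqP e; rewrite -oppr_eq0 -RRu e.
rewrite /turns_right RRu {xd}.
have -> : v + R u + - u - R u = v - u by rewrite -addrA addrACA subrr addr0.
rewrite /write.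
have -> : (v + R u == v + R u - u) = false.
  by apply/negbTE; rewrite -subr_eq0 opprD addrA subrr add0r opprK.
have -> : (v + R u == v) = false.
  by apply/negbTE; rewrite -subr_eq0 addrAC subrr add0r.
have -> : (v - u == v + R u - u) = false.
  apply/negbTE; rewrite (inj_eq (addIr _)) eq_sym -subr_eq0.
  by rewrite addrAC subrr add0r.
have -> : (v - u == v) = false.
  by apply/negbTE; rewrite -subr_eq0 addrAC subrr add0r oppr_eq0.
by rewrite xe; case: (x (v - u)); rewrite ?andbF.
Qed.

(** Inside the doubled bracket, a left turn and a straight move lower the quadratic part by 4 and 2
    and raise the [turns_right] term by at most 1; a right turn keeps the quadratic part and clears
    that term. The bracket thus drops by at least 1, and doubling leaves room for [is_star] to rise
    to 1. *)
Lemma potential_step (B : seq Z2) (o : Z2) (q : state) (v : Z2)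
    (x : Z2 -> bool) :
  uniq B -> (forall e : Z2, `|e.1| <= 1 -> `|e.2| <= 1 -> v + e \in B) ->
  potential B o (step (q, v, x)) <= potential B o (q, v, x) - 1.
Proof.
move=> uB nB; have [|] := boolP (is_star q).
  case: q => // _; rewrite /potential /dir /=.
  by set E := _ * _; rewrite addr0 addrK.
move=> nq; have vB : v \in B by rewrite -[v]addr0 nB.
have u2 := dir_unit q.
have u0 : dir q != 0 by case: (q).
have small : `|(dir q).1 + (R (dir q)).1| <= 1 /\
  `|(dir q).2 + (R (dir q)).2| <= 1 /\ `|(R (dir q)).1 - (dir q).1| <= 1 /\
  `|(R (dir q)).2 - (dir q).2| <= 1 by case: (q).
have [q' [-> dq']] := step_move v x nq.
have star_le1 : (is_star q')%:R <= 1 :> int by case: (is_star q').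
rewrite /potential (negPf nq).
set u := dir q in u2 u0 small dq' *.
case: ifP dq' => [tl|_] dq'.
  have ntr : turns_right u v x = false.
    by case/and3P: tl => /eqP xv _ _; rewrite /turns_right xv.
  case/and3P: tl => /eqP xv /eqP xd _.
  have dB : v + u + R u \in B by rewrite -addrA nB //; tauto.
  (* The two rewritten cells are distinct because they carry different symbols, so the second write
     still sees the original 1. *)
  have xd' : write x v true (v + u + R u).
    by rewrite /write; case: eqP => // e; rewrite e xv in xd.
  rewrite ntr !big_write // xv xd' dq' {xd'}; set tr := turns_right _ _ _.
  have : tr%:R <= 1 :> int by case: tr.
  set S := \sum_(_ <- _ | _) _.
  (* The multiples of the product of [v - o] and [R u] coming from the moved 1 and from the new
     direction cancel. *)
  have : dot (v - o) (v - o) - dot (v + u + R u - o) (v + u + R u - o)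
    - 2 * dot (v + - R u - o) (- R u) = - 2 * dot (v - o) u - 4.
    move: u2; rewrite /dot /R /=; nra.
  by rewrite /= ?mulr1n ?mulr0n; lra.
case: ifP dq' => [tr|_] dq'.
  have := no_two_right_turns u0 tr.
  case/and3P: tr => /eqP xv /eqP xd _.
  have dB : v + R u - u \in B by rewrite -addrA nB //; tauto.
  rewrite dq' => /negPf ->.
  have xd' : write x v false (v + R u - u) = false.
    by rewrite /write; case: eqP.
  rewrite !big_write // xv xd'.
  set S := \sum_(_ <- _ | _) _.
  have : - dot (v - o) (v - o) + dot (v + R u - u - o) (v + R u - u - o)
    - 2 * dot (v + R u - o) (R u) = - 2 * dot (v - o) u.
    move: u2; rewrite /dot /R /=; nra.
  by rewrite /= ?mulr1n ?mulr0n; lra.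
rewrite dq'; set tr := turns_right _ _ _.
have : tr%:R <= 1 :> int by case: tr.
set S := \sum_(_ <- _ | _) _.
have : dot (v + u - o) u = dot (v - o) u + 1.
  move: u2; rewrite /dot /=; nra.
by rewrite /= ?mulr0n; lra.
Qed.

(** A margin of one cell suffices, since a turn rewrites only the cell of the head and one of its
    diagonal neighbours. *)
Definition enlarged (o : Z2) (n : nat) : seq Z2 :=
  [seq (o.1 + i%:Z - 1, o.2 + j%:Z - 1) | i <- iota 0 n.+2, j <- iota 0 n.+2].

Lemma enlarged_uniq (o : Z2) (n : nat) : uniq (enlarged o n).
Proof.
apply: allpairs_uniq; rewrite ?iota_uniq // => -[i j] [i' j'] _ _ /= [e1 e2].
by congr pair; lia.
Qed.

Lemma square_enlarged (o : Z2) (n : nat) (v e : Z2) :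
  v \in square o n -> `|e.1| <= 1 -> `|e.2| <= 1 -> v + e \in enlarged o n.
Proof.
rewrite inE /= !in_itv /= => /andP[/andP[l1 r1] /andP[l2 r2]] e1 e2.
apply/allpairsP; exists (absz (v.1 + e.1 - o.1 + 1), absz (v.2 + e.2 - o.2 + 1)).
rewrite !mem_iota /=; split; [lia|lia|].
by rewrite [LHS](_ : _ = (v.1 + e.1, v.2 + e.2)) //; congr pair => /=; lia.
Qed.

Lemma potential_bound (o : Z2) (n : nat) (q : state) (v : Z2)
    (x : Z2 -> bool) :
  (1 <= n)%N -> v \in square o n ->
  - (4 * n%:Z) <= potential (enlarged o n) o (q, v, x)
    <= 36 * n%:Z ^+ 4 + 4 * n%:Z + 3.
Proof.
move=> n1; rewrite inE /= !in_itv /= => /andP[/andP[l1 r1] /andP[l2 r2]].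
have : `|dot (v - o) (dir q)| <= n%:Z - 1.
  by rewrite /dot; case: q => /=; lia.
have : 0 <= ((turns_right (dir q) v x)%:R : int) <= 1 by case: turns_right.
have : 0 <= ((is_star q)%:R : int) <= 1 by case: q.
(* Relative to [o] the coordinates lie between -1 and [n], so each cell contributes at most 2n^2,
   and there are (n+2)^2 <= 9n^2 cells. *)
have : 0 <= \sum_(z <- enlarged o n | x z) dot (z - o) (z - o)
    <= 18 * n%:Z ^+ 4.
  apply/andP; split.
    by apply: sumr_ge0 => z _; rewrite addr_ge0 // -expr2 sqr_ge0.
  have le_dot z : z \in enlarged o n ->
      0 <= dot (z - o) (z - o) <= 2 * n%:Z ^+ 2.
    case/allpairsP=> -[i j] [].
    rewrite !mem_iota => /andP[_ li] /andP[_ lj] ->.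
    have sqr_le (a k : int) : 0 <= k <= n%:Z + 1 ->
        0 <= (a + k - 1 - a) * (a + k - 1 - a) <= n%:Z ^+ 2.
      move=> k_le; have -> : a + k - 1 - a = k - 1 by ring.
      by rewrite expr2; nia.
    rewrite /dot /= in li lj *.
    have := sqr_le o.1 i; have := sqr_le o.2 j; lia.
  have size_enlarged : size (enlarged o n) = (n.+2 * n.+2)%N.
    by rewrite size_allpairs !size_iota.
  apply: (@le_trans _ _ (\sum_(z <- enlarged o n) 2 * n%:Z ^+ 2)).
    rewrite big_mkcond /= !big_seq; apply: ler_sum => z /le_dot.
    by case: (x z); lia.
  rewrite big_const_seq count_predT size_enlarged iter_addr_0.
  rewrite -[leLHS]mulr_natl natrM (_ : n.+2%:R = n%:Z + 2); last by rewrite natz; lia.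
  have : (n%:Z + 2) * (n%:Z + 2) <= 9 * n%:Z ^+ 2 by rewrite expr2; nia.
  have : 0 <= n%:Z ^+ 2 by rewrite sqr_ge0.
  by rewrite (_ : n%:Z ^+ 4 = n%:Z ^+ 2 * n%:Z ^+ 2) -?exprD //; nra.
rewrite /potential ler_norml; set S := \sum_(_ <- _ | _) _.
by move=> /andP[S0 Sn] /andP[s0 s1] /andP[t0 t1] /andP[d0 d1]; apply/andP; lra.
Qed.

Theorem lemma5 :
  exists c : nat, (0 < c)%N /\
    forall (n : nat) (u : Z2) (q : state) (v : Z2) (x : Z2 -> bool),
      (1 <= n)%N -> v \in square u n ->
      exists t : nat, (t <= c * n ^ 4)%N /\
        exists (p : state) (w : Z2) (y : Z2 -> bool),
          iter t M (head_at q v, x) = (head_at p w, y) /\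
          w \notin square u n.
Proof.
(* If the head were still inside after 48n^4 steps, the bounds on the potential would give 48n^4 <=
   36n^4 + 8n + 3, which fails since n^4 >= n >= 1. *)
exists 48%N; split=> // n u q v x n1 vS.
pose s t := iter t step (q, v, x).
have [[t [le_t out]]|stay] :=
    pselect (exists t, (t <= 48 * n ^ 4)%N /\ (s t).1.2 \notin square u n).
  exists t; split=> //; exists (s t).1.1, (s t).1.2, (s t).2.
  by rewrite iter_M -/(s t); case: (s t) out => -[].
have inside t : (t <= 48 * n ^ 4)%N -> (s t).1.2 \in square u n.
  by move=> le_t; apply/negPn/negP => out; apply: stay; exists t.
have drop t : (t <= 48 * n ^ 4)%N ->
    potential (enlarged u n) u (s t) <=
    potential (enlarged u n) u (q, v, x) - t%:Z.
  elim: t => [|t IH] le_t; first by rewrite subr0.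
  have := IH (ltnW le_t); have := inside t (ltnW le_t); rewrite /s iterS.
  case: (iter t step _) => -[p w] y /= wS IHt.
  have := potential_step u p y (enlarged_uniq u n)
            (fun e => square_enlarged wS).
  by move: IHt; rewrite -/(potential _ _ (p, w, y)); lia.
have := drop _ (leqnn _); have := inside _ (leqnn _).
case: (s _) => -[p w] y /= wS.
have /andP[_ hi] := potential_bound q x n1 vS.
have /andP[lo _] := potential_bound p y n1 wS.
rewrite -/(potential _ _ (p, w, y)) -/(potential _ _ (q, v, x)).
have : n%:Z <= n%:Z ^+ 4 by rewrite -[leLHS]expr1 ler_weXn2l //; lia.
have -> : (48 * n ^ 4)%N%:Z = 48 * n%:Z ^+ 4.
  by rewrite PoszM -[(n ^ 4)%N%:Z]natz natrX natz.
have : 1 <= n%:Z by lia.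
by lra.
Qed.
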